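(* There exists an absolute constant $C_3>0$ with the following property. Let $r,s\ge2$ be integers with $rs\le n$, set $\mu=n/(rs)$, and let $1\le\kappa\le\sqrt s$. Then there exists a rank-$r$ matrix $X_\star\in\mathbb R^{n\times n}$ which is incoherent with parameter $\mu$ and has condition number $\kappa$, such that for every $$0<q<C_3\frac{\mu\kappa^2r}{n},$$ the spectral estimate $$X_0=\mathcal H_r\big(q^{-1}\mathcal P_\Lambda(X_\star)\big),\qquad\Lambda\sim\operatorname{Bernoulli}(q),$$ satisfies $$\Pr\Big\{\|X_0-X_\star\|_\sharp\ge\tfrac12\sigma_r(X_\star)\Big\}\ge\tfrac12.$$
   Context: For $X_\star$ of rank $r$ with compact SVD $X_\star=U_\star\Sigma_\star V_\star^T$ and nonzero singular values $\sigma_1(X_\star)\ge\dots\ge\sigma_r(X_\star)>0$, the condition number is $\sigma_1(X_\star)/\sigma_r(X_\star)$, and $X_\star$ is incoherent with parameter $\mu$ if $\max_i\|U_\star^Te_i\|_2^2\le\mu r/n$ and $\max_j\|V_\star^Te_j\|_2^2\le\mu r/n$. $\Lambda\sim\operatorname{Bernoulli}(q)$ means that each $(i,j)\in\{1,\dots,n\}^2$ belongs to $\Lambda$ independently with probability $q$; $\mathcal P_\Lambda$ keeps the entries indexed by $\Lambda$ and sets the others to zero. For $Y\in\mathbb R^{n\times n}$, $\mathcal H_r(Y)\in\arg\min_{\operatorname{rank}(Z)\le r}\|Y-Z\|_{\mathrm F}$ denotes a fixed best rank-$r$ approximation (a fixed selection of minimizers). With $\|Z\|_{2,\infty}=\max_i\|e_i^TZ\|_2$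 and $\|Z\|_\infty=\max_{i,j}|Z_{ij}|$, the sharp norm (with parameters $n,\mu,r$) is $$\|Z\|_\sharp=\max\Big\{\|Z\|_{\mathrm{op}},\ \tfrac12\sqrt{\tfrac n{\mu r}}\|Z\|_{2,\infty},\ \tfrac12\sqrt{\tfrac n{\mu r}}\|Z^T\|_{2,\infty},\ \tfrac n{4\mu r}\|Z\|_\infty\Big\}.$$ *)

(* Defs.v *)
From HB Require Import structures.
From mathcomp Require Import all_boot all_order all_algebra.
From mathcomp Require Import all_classical all_reals matrix_normedtype.

Set Implicit Arguments.
Unset Strict Implicit.
Unset Printing Implicit Defensive.

Import Order.TTheory GRing.Theory Num.Theory.

Local Open Scope ring_scope.
Local Open Scope classical_set_scope.

Section Norms.
Variable R : realType.

(* On row and column vectors this is the Euclidean norm. *)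
Definition frob_norm (m n : nat) (A : 'M[R]_(m, n)) : R :=
  Num.sqrt (\sum_(i < m) \sum_(j < n) A i j ^+ 2).

Definition op_norm (m n : nat) (A : 'M[R]_(m, n)) : R :=
  sup [set frob_norm (A *m x) | x in [set x : 'cV[R]_n | frob_norm x <= 1]].

Definition norm_2_infty (m n : nat) (A : 'M[R]_(m, n)) : R :=
  \big[Num.max/0]_(i < m) frob_norm (row i A).

(* [mx_norm] is the largest absolute value of an entry. *)
Definition sharp_norm (n : nat) (mu : R) (r : nat) (Z : 'M[R]_n) : R :=
  let c := Num.sqrt (n%:R / (mu * r%:R)) in
  Num.max (op_norm Z)
    (Num.max (2^-1 * c * norm_2_infty Z)
       (Num.max (2^-1 * c * norm_2_infty Z^T)
          (n%:R / (4 * mu * r%:R) * mx_norm Z))).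

End Norms.

Section SVD.
Variables (R : realType) (n r : nat).

(* The singular values are sigma`_0 >= ... >= sigma`_r.-1 > 0. *)
Definition compact_svd (X : 'M[R]_n) (U : 'M[R]_(n, r)) (sigma : r.-tuple R)
    (V : 'M[R]_(n, r)) : Prop :=
  [/\ U^T *m U = 1%:M,
      V^T *m V = 1%:M,
      sorted >=%R sigma,
      (forall i, 0 < tnth sigma i) &
      X = U *m diag_mx (\row_i tnth sigma i) *m V^T].

(* [row i U] is the transpose of U^T e_i. *)
Definition incoherent (mu : R) (U V : 'M[R]_(n, r)) : Prop :=
  (forall i, frob_norm (row i U) ^+ 2 <= mu * r%:R / n%:R) /\
  (forall j, frob_norm (row j V) ^+ 2 <= mu * r%:R / n%:R).

Definition best_rank_approx (Y Z : 'M[R]_n) : Prop :=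
  (\rank Z <= r)%N /\
  forall W : 'M[R]_n,
    (\rank W <= r)%N -> frob_norm (Y - Z) <= frob_norm (Y - W).

Definition best_rank_selection (H : 'M[R]_n -> 'M[R]_n) : Prop :=
  forall Y, best_rank_approx Y (H Y).

End SVD.

Section Sampling.
Variables (R : realType) (n : nat).

Definition sample (L : {set 'I_n * 'I_n}) (X : 'M[R]_n) : 'M[R]_n :=
  \matrix_(i, j) (if (i, j) \in L then X i j else 0).

(* The law of a random subset containing each pair independently with
   probability q, as a weight on the finite type of all subsets. *)
Definition bernoulli_weight (q : R) (L : {set 'I_n * 'I_n}) : R :=
  \prod_(p : 'I_n * 'I_n) (if p \in L then q else 1 - q).

Definition bernoulli_pr (q : R) (E : pred {set 'I_n * 'I_n}) : R :=
  \sum_(L | E L) bernoulli_weight q L.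

End Sampling.

Arguments best_rank_approx {R n} r Y Z.
Arguments best_rank_selection {R n} r H.

(* Main.v *)
(* The error bound holds for every sampling set, not just with probability 1/2.
   X is supported on r diagonal blocks of size s, each constant, with singular
   values kappa, 1, ..., 1; let u be the singular vector of the kappa-block, and
   put Y = q^-1 P_L(X), Z = H_r(Y).
   Suppose |Z - X|_op < 1/2. As r >= 2, if Z has rank r, its row space contains
   a unit vector w orthogonal to u, and |Z w| < |X w| + 1/2 <= 3/2. If a unit
   vector x had |(Y - Z) x| > |Z w|, exchanging w for x would improve the best
   approximation Z (and if Z has rank less than r, then Y = Z); so
   |(Y - Z) x| <= 3/2 and |(Y - X) x| < 2 for all unit vectors x. But q is too
   small for that:
   - if kappa < 4, one sampled entry of the kappa-block already exceeds 2 in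
     Y - X, and if there is none then Y u = 0, so Z u = 0 and
     |(Z - X) u| = kappa >= 1;
   - if kappa >= 4, then u^T (Y - X) u > -2 forces at least s^2 q / 2 sampled
     entries in the block, and some column of Y - X is longer than 2. *)
Require Import Defs.
From HB Require Import structures.
From mathcomp Require Import all_boot all_order all_algebra.
From mathcomp Require Import all_classical all_reals matrix_normedtype.
From mathcomp Require Import zify ring lra.

Set Implicit Arguments.
Unset Strict Implicit.
Unset Printing Implicit Defensive.

Import Order.TTheory GRing.Theory Num.Theory.

Local Open Scope ring_scope.

(** * Frobenius and operator norms *)

Section Frobenius.
Variable R : realType.

Lemma frob_norm_ge0 m n (A : 'M[R]_(m, n)) : 0 <= frob_norm A.
Proof. exact: sqrtr_ge0. Qed.

Lemma sqr_frob_norm m n (A : 'M[R]_(m, n)) :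
  frob_norm A ^+ 2 = \sum_i \sum_j A i j ^+ 2.
Proof.
by rewrite sqr_sqrtr //; apply: sumr_ge0 => i _; apply: sumr_ge0 => j _;
  exact: sqr_ge0.
Qed.

Lemma frob_normE m n (A : 'M[R]_(m, n)) : frob_norm A ^+ 2 = \tr (A^T *m A).
Proof.
rewrite sqr_frob_norm exchange_big; apply: eq_bigr => j _.
by rewrite mxE; apply: eq_bigr => i _; rewrite mxE expr2.
Qed.

Lemma frob_norm_tr m n (A : 'M[R]_(m, n)) : frob_norm A^T = frob_norm A.
Proof.
congr Num.sqrt; rewrite exchange_big; apply: eq_bigr => i _.
by apply: eq_bigr => j _; rewrite mxE.
Qed.

Lemma frob_norm_eq0 m n (A : 'M[R]_(m, n)) : frob_norm A = 0 -> A = 0.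
Proof.
move=> A0; apply/matrixP => i j; rewrite mxE.
have /eqP := sqr_frob_norm A; rewrite A0 expr0n /= eq_sym psumr_eq0; last first.
  by move=> k _; apply: sumr_ge0 => l _; exact: sqr_ge0.
move=> /allP/(_ i (mem_index_enum _)) /=; rewrite psumr_eq0; last first.
  by move=> l _; exact: sqr_ge0.
by move=> /allP/(_ j (mem_index_enum _)) /=; rewrite sqrf_eq0 => /eqP.
Qed.

Lemma trmx_mul_symm m n (A B : 'M[R]_(m, n)) : \tr (A^T *m B) = \tr (B^T *m A).
Proof. by rewrite -mxtrace_tr trmx_mul trmxK. Qed.

Lemma sqr_frob_normD m n (A B : 'M[R]_(m, n)) :
  frob_norm (A + B) ^+ 2 =
  frob_norm A ^+ 2 + 2 * \tr (A^T *m B) + frob_norm B ^+ 2.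
Proof.
rewrite !frob_normE (raddfD trmx) mulmxDl !mulmxDr !mxtraceD.
by rewrite (trmx_mul_symm B A); ring.
Qed.

Lemma sqr_frob_normZ m n (a : R) (A : 'M[R]_(m, n)) :
  frob_norm (a *: A) ^+ 2 = a ^+ 2 * frob_norm A ^+ 2.
Proof.
rewrite !sqr_frob_norm mulr_sumr; apply: eq_bigr => i _.
by rewrite mulr_sumr; apply: eq_bigr => j _; rewrite mxE exprMn.
Qed.

Lemma frob_normN m n (A : 'M[R]_(m, n)) : frob_norm (- A) = frob_norm A.
Proof.
by congr Num.sqrt; apply: eq_bigr => i _; apply: eq_bigr => j _;
  rewrite mxE sqrrN.
Qed.

Lemma frob_cauchy_schwarz m n (A B : 'M[R]_(m, n)) :
  `|\tr (A^T *m B)| <= frob_norm A * frob_norm B.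
Proof.
wlog c_ge0 : A / 0 <= \tr (A^T *m B) => [wl|].
  have [|/ltW c_le0] := leP 0 (\tr (A^T *m B)); first exact: wl.
  have := wl (- A); rewrite linearN /= mulNmx raddfN /= frob_normN normrN.
  by apply; rewrite oppr_ge0.
rewrite ger0_norm //; clear c_ge0.
have [b0|b0] := boolP (frob_norm B == 0).
  by rewrite (frob_norm_eq0 (eqP b0)) mulmx0 mxtrace0 mulr_ge0 ?frob_norm_ge0.
have bgt : 0 < frob_norm B by rewrite lt_def frob_norm_ge0 andbT.
(* With [a], [b] the norms of [A], [B] and [c] the trace, this square expands to
   [2 a b (a b - c)]. *)
have := sqr_ge0 (frob_norm (frob_norm B *: A + (- frob_norm A) *: B)).
rewrite sqr_frob_normD !sqr_frob_normZ -scalemxAr mxtraceZ.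
rewrite (trmx_mul_symm (_ *: _)) -scalemxAr mxtraceZ (trmx_mul_symm B A).
set c := \tr _; set a := frob_norm A.
have [a0|a0] := boolP (a == 0).
  rewrite /c (frob_norm_eq0 (eqP a0)) trmx0 mul0mx mxtrace0.
  by rewrite (eqP a0) mul0r.
have agt : 0 < a by rewrite lt_def frob_norm_ge0 andbT.
move: bgt; set b := frob_norm B => bgt h.
have : 0 <= a * b * (a * b - c) by nra.
by rewrite pmulr_rge0 ?mulr_gt0 // subr_ge0.
Qed.

Lemma ler_frob_normD m n (A B : 'M[R]_(m, n)) :
  frob_norm (A + B) <= frob_norm A + frob_norm B.
Proof.
rewrite -(@ler_pXn2r _ 2) ?nnegrE ?addr_ge0 ?frob_norm_ge0 //.
rewrite sqr_frob_normD.
have := le_trans (ler_norm _) (frob_cauchy_schwarz A B); nra.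
Qed.

Lemma frob_norm_mulmx m n (A : 'M[R]_(m, n)) (x : 'cV[R]_n) :
  frob_norm (A *m x) <= frob_norm A * frob_norm x.
Proof.
rewrite -(@ler_pXn2r _ 2) ?nnegrE ?mulr_ge0 ?frob_norm_ge0 //.
rewrite exprMn [leLHS]sqr_frob_norm [in leRHS]sqr_frob_norm mulr_suml.
apply: ler_sum => i _; rewrite big_ord_recl big_ord0 addr0.
have -> : \sum_j A i j ^+ 2 = frob_norm (row i A)^T ^+ 2.
  rewrite frob_norm_tr sqr_frob_norm big_ord_recl big_ord0 addr0.
  by apply: eq_bigr => j _; rewrite mxE.
have -> : (A *m x) i 0 = \tr ((row i A)^T^T *m x).
  by rewrite trmxK -row_mul trace_mx11 !mxE.
rewrite -exprMn -[leLHS]real_normK ?num_real //.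
by rewrite ler_pXn2r ?nnegrE ?mulr_ge0 ?frob_norm_ge0 // frob_cauchy_schwarz.
Qed.

Lemma op_norm_ge m n (A : 'M[R]_(m, n)) (x : 'cV[R]_n) :
  frob_norm x <= 1 -> frob_norm (A *m x) <= op_norm A.
Proof.
move=> x1; apply: ub_le_sup; last by exists x.
(* [sup] dominates its set only when the set is bounded above; the Frobenius norm is such a
   bound. *)
exists (frob_norm A) => _ [y /= y1 <-].
by rewrite (le_trans (frob_norm_mulmx _ _)) // ler_piMr ?frob_norm_ge0.
Qed.

End Frobenius.

(** * Optimality conditions for best rank-r approximations *)

Section BestApproximation.
Variables (R : realType) (n r : nat).
Implicit Types (Y Z M : 'M[R]_n) (w x u : 'cV[R]_n).

(** First-order optimality: on a line through [Z] that respects the rank bound, the squared error is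
    a quadratic in [t] minimal at [t = 0]. *)
Lemma best_rank_approx_critical Y Z M :
  best_rank_approx r Y Z -> (forall t, (\rank (Z + t *: M)%R <= r)%N) ->
  \tr ((Y - Z)^T *m M) = 0.
Proof.
move=> [_ Zmin] rkM; set c := \tr _.
have ineq t : 0 <= t ^+ 2 * frob_norm M ^+ 2 - 2 * t * c.
  have := Zmin _ (rkM t); rewrite -(@ler_pXn2r _ 2) ?nnegrE ?frob_norm_ge0 //.
  rewrite opprD addrA -scaleNr (sqr_frob_normD (Y - Z)) sqr_frob_normZ.
  by rewrite -scalemxAr mxtraceZ -/c; lra.
(* At this [t] the quadratic equals [- t^2 (b + 2)], which forces [t = 0]; the [+ 1] keeps the
   denominator positive when [M = 0]. *)
move: (ineq (c / (frob_norm M ^+ 2 + 1))); set b := frob_norm M ^+ 2.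
have b0 : 0 <= b by exact: sqr_ge0.
have b1 : 0 < b + 1 by lra.
set t := c / (b + 1) => ht; have ct : c = t * (b + 1) by rewrite divfK ?gt_eqF.
have t0 : t = 0 by rewrite ct in ht; nra.
by rewrite ct t0 mul0r.
Qed.

(** The direction [M = Z Z^T (Y - Z)] is admissible, since [Z + t M] is [Z] times a matrix; the
    derivative along it is [|Z^T (Y - Z)|^2], up to a constant factor. *)
Lemma best_rank_approx_residual_orthl Y Z :
  best_rank_approx r Y Z -> Z^T *m (Y - Z) = 0.
Proof.
move=> ZY; apply: frob_norm_eq0; apply/eqP.
rewrite -(sqrf_eq0 (frob_norm _)) frob_normE trmx_mul trmxK -mulmxA; apply/eqP.
apply: (best_rank_approx_critical ZY) => t; apply: (leq_trans _ ZY.1).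
by rewrite scalemxAr -{1}[Z]mulmx1 -mulmxDr mxrankM_maxl.
Qed.

Lemma frob_norm_outer m (a : 'cV[R]_m) w :
  frob_norm (a *m w^T) ^+ 2 = frob_norm a ^+ 2 * frob_norm w ^+ 2.
Proof.
rewrite !sqr_frob_norm big_distrl; apply: eq_bigr => i _ /=.
rewrite big_distrr; apply: eq_bigr => j _ /=.
by rewrite !big_ord1 mxE big_ord1 mxE exprMn.
Qed.

Lemma trmx_mul_outer Y x :
  \tr (Y^T *m (Y *m x *m x^T)) = frob_norm (Y *m x) ^+ 2.
Proof. by rewrite frob_normE trmx_mul mulmxA mxtrace_mulC !mulmxA. Qed.

(* Trading the direction [w] of the row space of [Z] for the direction [x] of
   the residual keeps the rank and changes the squared error by
   [|Z w|^2 - |(Y - Z) x|^2]. *)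
Lemma best_rank_approx_exchange Y Z w x :
  best_rank_approx r Y Z -> (w^T <= Z)%MS -> frob_norm w = 1 ->
  frob_norm x = 1 -> frob_norm ((Y - Z) *m x) <= frob_norm (Z *m w).
Proof.
move=> ZY wZ w1 x1; set D := Y - Z.
have ZD : Z^T *m D = 0 by exact: best_rank_approx_residual_orthl.
have ww : w^T *m w = 1%:M.
  by rewrite [LHS]mx11_scalar -trace_mx11 -frob_normE w1 expr1n.
have rkW : (\rank (Z - Z *m w *m w^T + D *m x *m x^T)%R <= r)%N.
  apply: (leq_trans (mxrank_add _ _)).
  have := mxrankM_maxl (D *m x) x^T; move: (rank_leq_col (D *m x)).
  move=> /(leq_trans _) h /h {}h.
  (* The new matrix kills [w], so its row space loses [w^T]; the rank drop makes room for the
     rank-one term in [x]. *)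
  suff : (\rank (Z - Z *m w *m w^T)%R < \rank Z)%N.
    move=> rkZ; apply: leq_trans (leq_trans rkZ ZY.1); rewrite -[leqRHS]addn1.
    by rewrite leq_add2l.
  apply: rank_ltmx; rewrite ltmxE.
  have sub : (Z - Z *m w *m w^T <= Z)%MS.
    by rewrite addmx_sub ?submx_refl // eqmx_opp mulmx_sub.
  rewrite sub /=; apply/negP => /(submx_trans wZ)/submxP[a wE].
  have : w^T *m w = 0.
    by rewrite wE -(mulmxA a) mulmxBl -(mulmxA (Z *m w)) ww mulmx1 subrr mulmx0.
  by rewrite ww => /matrixP/(_ 0 0)/eqP; rewrite !mxE oner_eq0.
have := ZY.2 _ rkW; rewrite -(@ler_pXn2r _ 2) ?nnegrE ?frob_norm_ge0 //.
have -> : Y - (Z - Z *m w *m w^T + D *m x *m x^T) =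
    (D - D *m x *m x^T) + Z *m w *m w^T.
  by rewrite !opprD opprK !addrA addrAC.
rewrite (sqr_frob_normD (D - _)) (sqr_frob_normD D) frob_normN !frob_norm_outer.
rewrite mulmxN raddfN /= trmx_mul_outer w1 x1 -/D.
(* No cross term: by [ZD] the column spaces of [D] and [Z] are orthogonal. *)
have -> : (D - D *m x *m x^T)^T *m (Z *m w *m w^T) = 0.
  set A := D - _; rewrite !(mulmxA A^T) -[A^T *m Z]trmxK trmx_mul trmxK mulmxBr.
  by rewrite !mulmxA ZD !mul0mx subrr trmx0 !mul0mx.
rewrite raddf0 => h; rewrite -(@ler_pXn2r _ 2) ?nnegrE ?frob_norm_ge0 //; lra.
Qed.

Lemma best_rank_approx_residual_le Y Z u x (c : R) :
  best_rank_approx r Y Z -> (1 < r)%N -> 0 <= c ->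
  (forall w, frob_norm w = 1 -> w^T *m u = 0 -> frob_norm (Z *m w) <= c) ->
  frob_norm x = 1 -> frob_norm ((Y - Z) *m x) <= c.
Proof.
move=> ZY r_gt1 c0 Zc x1.
have [rkZ|rkZ] := ltnP (\rank Z) r.
  (* Below rank [r] every rank-one direction is admissible, in particular [(Y - Z) x x^T]. *)
  suff /eqP : frob_norm ((Y - Z) *m x) ^+ 2 = 0 by rewrite sqrf_eq0 => /eqP ->.
  rewrite -trmx_mul_outer; apply: (best_rank_approx_critical ZY) => t.
  apply: leq_trans rkZ; apply: (leq_trans (mxrank_add _ _)).
  rewrite -[leqRHS]addn1 leq_add2l scalemxAl (leq_trans (mxrankM_maxr _ _)) //.
  exact: rank_leq_row.
(* [B] has at least two independent rows and [B u] is a single column, so some nonzero combination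
   [a B] of the rows is orthogonal to [u]. *)
set B := row_base Z; set a := nz_row (kermx (B *m u)).
have a0 : a != 0.
  rewrite nz_row_eq0 -mxrank_eq0 mxrank_ker -lt0n subn_gt0.
  by rewrite (leq_ltn_trans (rank_leq_col _)) // (leq_trans r_gt1).
have aBu : a *m B *m u = 0.
  by rewrite -mulmxA; apply/sub_kermxP; exact: nz_row_sub.
have v0 : frob_norm (a *m B) != 0.
  apply: contra_neq a0 => /frob_norm_eq0 aB0.
  by apply: (row_free_inj (row_base_free Z)); rewrite aB0 mul0mx.
set w := (frob_norm (a *m B))^-1 *: (a *m B)^T.
have wT : w^T = (frob_norm (a *m B))^-1 *: (a *m B) by rewrite linearZ /= trmxK.
have w1 : frob_norm w = 1.
  apply/eqP; rewrite -(@eqrXn2 _ 2) ?frob_norm_ge0 // expr1n.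
  by rewrite sqr_frob_normZ frob_norm_tr -exprMn mulVf // expr1n.
apply: (le_trans (best_rank_approx_exchange ZY _ w1 x1)).
  by rewrite wT scalemx_sub // (submx_trans (submxMl _ _)) // eq_row_base.
by apply: Zc => //; rewrite wT -scalemxAl aBu scaler0.
Qed.

End BestApproximation.

(** * Lower bound on the error from one sampled block *)

Section BlockEigenvector.
Variables (R : realType) (n s r : nat) (B : {set 'I_n}) (kappa q : R).
Variables (X Z : 'M[R]_n) (L : {set 'I_n * 'I_n}).

Let u : 'cV[R]_n := \col_i ((i \in B)%:R / Num.sqrt s%:R).
Let Y : 'M[R]_n := q^-1 *: sample L X.
Let hits : R := \sum_(j in B) \sum_(i in B) ((i, j) \in L)%:R.

Hypotheses (cardB : #|B| = s) (r_gt1 : (1 < r)%N).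
Hypotheses (kappa_ge1 : 1 <= kappa) (kappa_le : kappa ^+ 2 <= s%:R).
Hypotheses (q_gt0 : 0 < q) (q_lt : q < 16^-1 * (kappa ^+ 2 / s%:R)).
Hypothesis Xu : X *m u = kappa *: u.
Hypothesis XB : forall i j, j \in B -> X i j = kappa / s%:R * (i \in B)%:R.
Hypothesis Xcontract :
  forall w : 'cV[R]_n, w^T *m u = 0 -> frob_norm (X *m w) <= frob_norm w.
Hypothesis ZY : best_rank_approx r Y Z.

Let s_gt0 : 0 < s%:R :> R.
Proof.
by apply: lt_le_trans kappa_le; rewrite exprn_gt0 // (lt_le_trans _ kappa_ge1).
Qed.

Let frob_u : frob_norm u = 1.
Proof.
apply/eqP; rewrite -(@eqrXn2 _ 2) ?frob_norm_ge0 // expr1n sqr_frob_norm.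
under eq_bigr do rewrite big_ord1 mxE exprMn exprVn expr2 -natrM mulnb andbb.
rewrite -mulr_suml sqr_sqrtr ?(ltW s_gt0) //.
under eq_bigr do rewrite mulrb.
by rewrite -big_mkcond sumr_const cardB divff ?(gt_eqF s_gt0).
Qed.

Let diffB i j : j \in B ->
  (Y - X) i j = kappa / s%:R * (((i, j) \in L)%:R / q - 1) * (i \in B)%:R.
Proof.
by move=> jB; rewrite !mxE XB //; case: ifP => _ /=; ring.
Qed.

Section SmallError.
Hypothesis err_lt : op_norm (Z - X) < 2^-1.

Let diff_lt (x : 'cV[R]_n) : frob_norm x = 1 -> frob_norm ((Y - X) *m x) < 2.
Proof.
move=> x1.
have err (y : 'cV[R]_n) : frob_norm y = 1 -> frob_norm ((Z - X) *m y) < 2^-1.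
  by move=> y1; apply: le_lt_trans err_lt; apply: op_norm_ge; rewrite y1.
have res : frob_norm ((Y - Z) *m x) <= 3 / 2.
  apply: (best_rank_approx_residual_le (u := u) ZY) => //; first by lra.
  move=> w w1 wu; have -> : Z *m w = (Z - X) *m w + X *m w.
    by rewrite mulmxBl subrK.
  have := ler_frob_normD ((Z - X) *m w) (X *m w).
  by have := err _ w1; have := Xcontract wu; rewrite w1; lra.
have -> : (Y - X) *m x = (Y - Z) *m x + (Z - X) *m x.
  by rewrite -mulmxDl addrA subrK.
by have := ler_frob_normD ((Y - Z) *m x) ((Z - X) *m x); have := err _ x1; lra.
Qed.

(** The test vector is the [j]-th basis vector: the sampled block entries alone contribute the left
    side to the squared norm of column [j] of [Y - X]. *)
Let column_hits j : j \in B ->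
  (\sum_(i in B) ((i, j) \in L)%:R) * (kappa / s%:R * (q^-1 - 1)) ^+ 2 < 4 :> R.
Proof.
move=> jB; set x : 'cV[R]_n := delta_mx j 0.
have x1 : frob_norm x = 1.
  apply/eqP; rewrite -(@eqrXn2 _ 2) ?frob_norm_ge0 // expr1n sqr_frob_norm.
  rewrite (bigD1 j) //= big_ord1 mxE !eqxx expr1n big1 ?addr0 // => i ij.
  by rewrite big_ord1 mxE (negPf ij) expr0n.
apply: (@le_lt_trans _ _ (frob_norm ((Y - X) *m x) ^+ 2)); last first.
  have := diff_lt x1; have := frob_norm_ge0 ((Y - X) *m x); nra.
rewrite -colE sqr_frob_norm mulr_suml big_mkcond /=; apply: ler_sum => i _.
rewrite big_ord1 mxE diffB //; case: (i \in B); last by rewrite mulr0 expr0n.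
by rewrite mulr1; case: (_ \in L); rewrite ?mul1r // !mul0r sqr_ge0.
Qed.

Let total_hits : hits * (kappa / s%:R * (q^-1 - 1)) ^+ 2 <= 4 * s%:R.
Proof.
rewrite /hits mulr_suml mulr_natr -{2}cardB -sumr_const.
by apply: ler_sum => j /column_hits/ltW.
Qed.

(** The right side is the quadratic form of [Y - X] at [u], bounded by Cauchy-Schwarz. *)
Let block_mean : - 2 < kappa / s%:R ^+ 2 * (hits / q - s%:R ^+ 2).
Proof.
have -> : kappa / s%:R ^+ 2 * (hits / q - s%:R ^+ 2) =
    \tr (u^T *m ((Y - X) *m u)).
  rewrite trace_mx11 mulmxA mxE (eq_bigr (fun j : 'I_n => if j \in B then
    kappa / s%:R ^+ 2 * \sum_(i in B) (((i, j) \in L)%:R / q - 1) else 0)).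
    rewrite -big_mkcond -mulr_sumr; congr (_ * _).
    rewrite /hits mulr_suml.
    under [RHS]eq_bigr do rewrite sumrB -mulr_suml sumr_const cardB.
    by rewrite sumrB sumr_const cardB expr2 mulr_natr.
  move=> j _; rewrite !mxE; case: ifPn => jB; last by rewrite mul0r mulr0.
  rewrite mulr_suml mulr_sumr [RHS]big_mkcond; apply: eq_bigr => i _.
  rewrite diffB // !mxE mul1r; case: (i \in B); last by rewrite !mul0r.
  rewrite mul1r mulr1 mulrAC -expr2 exprVn sqr_sqrtr ?(ltW s_gt0) //.
  by field; rewrite ?gt_eqF.
have := frob_cauchy_schwarz u ((Y - X) *m u); have := diff_lt frob_u.
by rewrite frob_u mul1r ler_norml => ? /andP[]; lra.
Qed.

Let block_hit : exists2 j, j \in B & exists2 i, i \in B & (i, j) \in L.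
Proof.
apply: contrapT => nohit.
have Yu : Y *m u = 0.
  apply/matrixP => i k; rewrite !mxE big1 // => j _; rewrite !mxE.
  have [jB|] := boolP (j \in B); last by rewrite mul0r mulr0.
  case: ifPn => ijL; last by rewrite mulr0 mul0r.
  rewrite XB //; have [iB|] := boolP (i \in B); last by rewrite !(mulr0, mul0r).
  by case: nohit; exists j => //; exists i.
(* [Z^T (Y - Z) = 0] turns [Y u = 0] into [Z^T Z u = 0], and [|Z u|^2 = u^T Z^T Z u]. *)
have Zu : Z *m u = 0.
  apply/frob_norm_eq0/eqP; rewrite -(sqrf_eq0 (frob_norm _)) frob_normE.
  rewrite trmx_mul -mulmxA -[Z in Z *m u](subrK Y) -opprB.
  rewrite mulmxDl Yu addr0 mulNmx mulmxN (mulmxA Z^T).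
  by rewrite (best_rank_approx_residual_orthl ZY) mul0mx oppr0 mulmx0 raddf0.
have := op_norm_ge (Z - X) (_ : frob_norm u <= 1); rewrite frob_u lexx.
move=> /(_ isT); rewrite mulmxBl Zu Xu sub0r frob_normN => h.
have : frob_norm (kappa *: u) ^+ 2 = kappa ^+ 2.
  by rewrite sqr_frob_normZ frob_u expr1n mulr1.
by have := frob_norm_ge0 (kappa *: u); move: err_lt kappa_ge1; nra.
Qed.

Lemma small_error_contradiction : False.
Proof.
have pE : q^-1 * q = 1 by rewrite mulVf ?gt_eqF.
move: total_hits block_mean q_gt0 q_lt s_gt0 kappa_le kappa_ge1.
rewrite exprMn exprMn exprVn.
set p := q^-1 in pE *; set t : R := s%:R; set k := kappa; set N := hits.
move=> hN hm q0 q_small t0 k_le k_ge.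
have p_gt0 : 0 < p by rewrite invr_gt0.
have t_gt : 16 * t < p * k ^+ 2.
  move: q_small; rewrite mulrA ltr_pdivlMr // => h; nra.
have kt : k <= t by nra.
have [k4|k4] := ltP k 4.
  have [j jB [i iB ijL]] := block_hit.
  have : (k / t * (p - 1)) ^+ 2 < 4.
    apply: le_lt_trans (column_hits jB); rewrite (bigD1 i) //= ijL mulrDl mul1r.
    by rewrite lerDl mulr_ge0 ?sqr_ge0 // sumr_ge0.
  (* From [k < 4] and [16 t < p k^2] follows [4 t < p k]; then [k <= t] absorbs the [- 1]. *)
  have : 3 < k / t * (p - 1) by rewrite mulrAC ltr_pdivlMr //; nra.
  nra.
(* As [2 / k <= 1 / 2], at least half of the expected [q s^2] entries are sampled. *)
have Np : t ^+ 2 <= 2 * (N * p).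
  move: hm; rewrite mulrAC ltr_pdivlMr ?exprn_gt0 //; nra.
have p16 : 16 < p by nra.
have {}hN : N * (k ^+ 2 * (p - 1) ^+ 2) <= 4 * t ^+ 3.
  have -> : N * (k ^+ 2 * (p - 1) ^+ 2) =
      N * (k ^+ 2 * (t ^+ 2)^-1 * (p - 1) ^+ 2) * t ^+ 2.
    by field; rewrite gt_eqF.
  have -> : 4 * t ^+ 3 = 4 * t * t ^+ 2 by ring.
  by rewrite ler_pM2r ?exprn_gt0.
have N_ge0 : 0 <= N by do 2 (apply: sumr_ge0 => ? _).
(* [p > 16] gives [p - 1 >= (15/16) p]. With [hN] and the next inequality, [16 t^3 <= 2 N p^2 k^2 <=
   8 (16/15)^2 t^3 < 10 t^3], which is absurd. *)
have : N * (k ^+ 2 * ((15 / 16) * p) ^+ 2) <= N * (k ^+ 2 * (p - 1) ^+ 2).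
  by do 2 (rewrite ler_wpM2l ?sqr_ge0 //); rewrite ler_pXn2r ?nnegrE //; lra.
have : t ^+ 2 * (16 * t) <= 2 * (N * p) * (p * k ^+ 2).
  by apply: ler_pM => //; [exact: sqr_ge0 | lra | exact: ltW].
have : 0 < t ^+ 3 by rewrite exprn_gt0.
nra.
Qed.

End SmallError.

Lemma block_spectral_error_ge : 2^-1 <= op_norm (Z - X).
Proof. by rewrite leNgt; apply/negP => /small_error_contradiction. Qed.

End BlockEigenvector.

(** The total weight of all subsets is the expansion of a product of factors [q + (1 - q)]. *)
Lemma bernoulli_pr_sure (R : realType) n (q : R) (E : pred {set 'I_n * 'I_n}) :
  (forall L, E L) -> bernoulli_pr q E = 1.
Proof.
move=> sureE; rewrite /bernoulli_pr (eq_bigl xpredT) //.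
rewrite -(bigA_distr _ _ (fun=> q) (fun=> 1 - q)).
by rewrite big1 // => i _; rewrite /= addrC subrK.
Qed.

(** * Matrices [U D U^T] with orthonormal columns in [U] *)

Section OrthonormalColumns.
Variables (R : realType) (n r : nat) (U : 'M[R]_(n, r)).
Hypothesis UU : U^T *m U = 1%:M.

Lemma frob_norm_isometry (z : 'cV[R]_r) : frob_norm (U *m z) = frob_norm z.
Proof.
apply/eqP; rewrite -(@eqrXn2 _ 2) ?frob_norm_ge0 //; apply/eqP.
by rewrite !frob_normE trmx_mul -mulmxA (mulmxA U^T) UU mul1mx.
Qed.

(** Bessel's inequality, from [|w - U U^T w|^2 >= 0]. *)
Lemma frob_norm_trmx_le (w : 'cV[R]_n) : frob_norm (U^T *m w) <= frob_norm w.
Proof.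
rewrite -(@ler_pXn2r _ 2) ?nnegrE ?frob_norm_ge0 // -subr_ge0.
have := sqr_ge0 (frob_norm (w + - (U *m (U^T *m w)))).
rewrite sqr_frob_normD frob_normN frob_norm_isometry mulmxN raddfN /=.
have -> : \tr (w^T *m (U *m (U^T *m w))) = frob_norm (U^T *m w) ^+ 2.
  by rewrite frob_normE trmx_mul trmxK !mulmxA.
lra.
Qed.

Lemma mxrank_conj_diag (d : 'rV[R]_r) :
  (forall k, d 0 k != 0) -> \rank (U *m diag_mx d *m U^T) = r.
Proof.
move=> d0; apply/eqP; rewrite eqn_leq.
rewrite (leq_trans (mxrankM_maxr _ _)) ?rank_leq_row //=.
have D1 : diag_mx d \in unitmx.
  by rewrite unitmxE det_diag unitfE; apply/prodf_neq0 => k _.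
rewrite -{1}(mxrank_unit D1).
have {1}-> : diag_mx d = U^T *m (U *m diag_mx d *m U^T) *m U.
  by rewrite -!mulmxA UU mulmx1 mulmxA UU mul1mx.
by rewrite (leq_trans (mxrankM_maxl _ _)) // mxrankM_maxr.
Qed.

Lemma conj_diag_eigenvector (d : 'rV[R]_r) k :
  U *m diag_mx d *m U^T *m col k U = d 0 k *: col k U.
Proof.
rewrite colE -!mulmxA (mulmxA U^T) UU mul1mx scalemxAr; congr (U *m _).
apply/matrixP => i j; rewrite mul_diag_mx !mxE.
by case: eqP => [->|]; rewrite ?mulr0.
Qed.

(** The [k]-th coordinate of [U^T w] vanishes, so the diagonal factor fixes [U^T w]. *)
Lemma conj_diag_contraction (d : 'rV[R]_r) k (w : 'cV[R]_n) :
  (forall l, l != k -> d 0 l = 1) -> w^T *m col k U = 0 ->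
  frob_norm (U *m diag_mx d *m U^T *m w) <= frob_norm w.
Proof.
move=> d1 wk; have zk : (U^T *m w) k 0 = 0.
  have := congr1 (fun A : 'M_1 => A 0 0) wk; rewrite !mxE => wk0.
  by rewrite -[RHS]wk0; apply: eq_bigr => i _; rewrite !mxE mulrC.
rewrite -!mulmxA; have -> : diag_mx d *m (U^T *m w) = U^T *m w.
  rewrite mul_diag_mx; apply/matrixP => l j; rewrite [LHS]mxE (ord1 j).
  by have [->|lk] := eqVneq l k; rewrite ?zk ?mulr0 // d1 // mul1r.
by rewrite frob_norm_isometry frob_norm_trmx_le.
Qed.

End OrthonormalColumns.

(** * Normalized block indicators *)

Section Blocks.
Variables (R : realType) (n r s : nat).
Hypotheses (s_gt0 : (0 < s)%N) (rs_le : (r * s <= n)%N).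

(** Row [i] belongs to block [i %/ s]; rows from [r * s] on lie in no block and are zero. *)
Definition block_basis : 'M[R]_(n, r) :=
  \matrix_(i, k) (((i %/ s)%N == k)%:R / Num.sqrt s%:R).

Lemma card_block (k : 'I_r) : #|[set i : 'I_n | (i %/ s)%N == k]| = s.
Proof.
have lt_n (i : 'I_s) : (k * s + i < n)%N.
  by have := ltn_ord i; have := ltn_ord k; nia.
have inj_f : injective (fun i : 'I_s => Ordinal (lt_n i)).
  by move=> i j /(congr1 val) /= /addnI /val_inj.
rewrite -[RHS]card_ord -(card_imset predT inj_f); apply: eq_card => i.
rewrite !inE; apply/eqP/imsetP => [ik|[j _ ->]].
  exists (Ordinal (ltn_pmod i s_gt0)) => //; apply: val_inj => /=.
  by rewrite -ik -divn_eq.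
by rewrite /= divnMDl // divn_small ?addn0.
Qed.

Lemma block_basis_orthonormal : block_basis^T *m block_basis = 1%:M.
Proof.
apply/matrixP => k l; rewrite !mxE.
under eq_bigr do rewrite !mxE mulrACA -natrM mulnb -invfM -expr2.
rewrite sqr_sqrtr ?ler0n // -mulr_suml; have [->|kl] := eqVneq k l.
  under eq_bigr do rewrite andbb mulrb.
  rewrite -big_mkcond sumr_const.
  have -> : #|(fun i : 'I_n => (i %/ s)%N == l)| = s.
    by rewrite -[RHS](card_block l) cardsE.
  by rewrite divff // pnatr_eq0 -lt0n.
rewrite big1 ?mul0r // => i _; apply/eqP; rewrite pnatr_eq0 eqb0.
by apply/negP => /andP[/eqP ->]; rewrite (inj_eq val_inj) (negPf kl).
Qed.

(** Blocks are disjoint, so a row has at most one nonzero entry. *)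
Lemma block_basis_row_norm i :
  frob_norm (row i block_basis) ^+ 2 <= s%:R^-1.
Proof.
rewrite sqr_frob_norm big_ord1.
under eq_bigr do rewrite !mxE exprMn expr2 -natrM mulnb andbb exprVn mulrb.
rewrite -mulr_suml sqr_sqrtr ?ler0n // ler_piMl ?invr_ge0 ?ler0n //.
rewrite -big_mkcond sumr_const lern1.
apply/card_le1_eqP => k l /eqP ik /eqP il; apply: val_inj.
by rewrite /= -ik -il.
Qed.

End Blocks.

Theorem theorem3p4 (R : realType) :
  exists C3 : R, 0 < C3 /\
  forall (n r s : nat) (kappa : R) (H : 'M[R]_n -> 'M[R]_n),
    (2 <= r)%N -> (2 <= s)%N -> (r * s <= n)%N ->
    1 <= kappa -> kappa <= Num.sqrt s%:R ->
    best_rank_selection r H ->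
    let mu : R := n%:R / (r%:R * s%:R) in
    exists (X : 'M[R]_n) (U : 'M[R]_(n, r)) (sigma : r.-tuple R)
           (V : 'M[R]_(n, r)),
      [/\ \rank X = r,
          compact_svd X U sigma V,
          incoherent mu U V,
          sigma`_0 / sigma`_r.-1 = kappa &
          forall q : R,
            0 < q -> q < C3 * (mu * kappa ^+ 2 * r%:R / n%:R) ->
            2^-1 <= bernoulli_pr q (fun L : {set 'I_n * 'I_n} =>
              2^-1 * sigma`_r.-1 <=
              sharp_norm mu r (H (q^-1 *: sample L X) - X))].
Proof.
(* With this constant both cases, [kappa < 4] and [kappa >= 4], of [small_error_contradiction]
   close. *)
exists 16^-1; split; first by rewrite invr_gt0.
move=> n r s kappa H r_ge2 s_ge2 rs_le kappa1 kappa_le bestH mu.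
have s_gt0 : (0 < s)%N by exact: ltnW.
have r_gt0 : (0 < r)%N by exact: ltnW.
have n_gt0 : (0 < n)%N by rewrite (leq_trans _ rs_le) // muln_gt0 r_gt0.
have kappa_gt0 : 0 < kappa by exact: lt_le_trans kappa1.
(* [r >= 2] keeps the last index [r.-1] away from 0, so the smallest singular value is 1. *)
have [rp r1] : (r.-1 < r)%N /\ (r.-1 == 0%N) = false by lia.
(* This is the incoherence bound; times [kappa ^+ 2] it gives the threshold for [q]. *)
have muE : mu * r%:R / n%:R = s%:R^-1.
  by rewrite /mu; field; rewrite !pnatr_eq0 -!lt0n n_gt0 s_gt0 r_gt0.
pose k0 := Ordinal r_gt0; pose U := block_basis R n r s.
pose f (k : 'I_r) := if k == k0 then kappa else 1.
pose sigma := [tuple f k | k < r].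
have sigmaE j (jr : (j < r)%N) : sigma`_j = if j == 0%N then kappa else 1.
  by rewrite -[j in LHS]/(val (Ordinal jr)) nth_mktuple.
pose d := \row_i tnth sigma i.
have dE k : d 0 k = f k by rewrite mxE tnth_mktuple.
have f_gt0 k : 0 < f k by rewrite /f; case: eqP.
have UU : U^T *m U = 1%:M by exact: block_basis_orthonormal.
(* [X] is symmetric with positive nonzero eigenvalues, so [U] serves as both singular factors. *)
pose X := U *m diag_mx d *m U^T.
exists X, U, sigma, U; split.
- by apply: mxrank_conj_diag => // k; rewrite dE gt_eqF.
- split=> //; last by move=> i; rewrite tnth_mktuple.
  apply/(sortedP 0) => i; rewrite size_tuple => ir.
  by rewrite !sigmaE ?(ltnW ir) //=; case: eqP.
- by split=> i; rewrite muE; exact: block_basis_row_norm.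
- by rewrite !sigmaE // r1 divr1.
move=> q q_gt0; rewrite (_ : mu * _ * _ / _ = kappa ^+ 2 / s%:R); last first.
  by rewrite -muE; ring.
move=> q_lt; rewrite bernoulli_pr_sure ?invf_le1 ?ler1n // => L.
rewrite sigmaE // r1 mulr1 le_max.
apply/orP; left; set B := [set i : 'I_n | (i %/ s)%N == k0].
have uE : \col_i ((i \in B)%:R / Num.sqrt s%:R) = col k0 U.
  by apply/matrixP => i j; rewrite !mxE inE.
apply: (@block_spectral_error_ge _ n s r B kappa q) => //.
- exact: card_block.
- rewrite -[leRHS]sqr_sqrtr ?ler0n //.
  by rewrite ler_pXn2r ?nnegrE ?sqrtr_ge0 ?(ltW kappa_gt0).
- by rewrite uE conj_diag_eigenvector // dE /f eqxx.
(* In a column of the block only the [k0] term of the spectral sum survives. *)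
- move=> i j; rewrite inE => /eqP jB; rewrite /X mul_mx_diag mxE (bigD1 k0) //=.
  rewrite big1 ?addr0 => [|k kk0]; last first.
    by rewrite !mxE jB (inj_eq val_inj) (eq_sym k0) (negPf kk0) mul0r mulr0.
  rewrite !mxE tnth_mktuple /f eqxx jB eqxx inE mulr1n.
  rewrite -[s%:R in RHS]sqr_sqrtr ?ler0n //.
  by field; rewrite gt_eqF // sqrtr_gt0 ltr0n.
- move=> w; rewrite uE => /conj_diag_contraction; apply => // l lk0.
  by rewrite dE /f (negPf lk0).
Qed.
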